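(* Let $A_1=P_1J_1P_1^{-1}$ with $J_1=\begin{pmatrix}-\alpha_1&\beta_1\\-\beta_1&-\alpha_1\end{pmatrix}$, $\alpha_1>0$, $\beta_1\ne0$, and $A_2=P_2J_2P_2^{-1}$ with $J_2=\begin{pmatrix}n_2&1\\0&n_2\end{pmatrix}$, $n_2\ge0$; here $P_1,P_2$ are real invertible $2\times 2$ matrices chosen such that $M=P_2^{-1}P_1=\begin{pmatrix}a&b\\c&d\end{pmatrix}$ has determinant $1$ or $-1$. Given $\eta>0$, let $$\tau_{1,2}(\eta)=\frac{n_2}{\alpha_1}\eta+\frac1{\alpha_1}\sinh^{-1}\left(\left(\frac{c^2+d^2}{2}\right)\eta\right).$$ Then the switched system $\dot x(t)=A_{\sigma(t)}x(t)$ is stable for all $\sigma\in\mathcal S[\tau_{1,2}(\eta),\eta]$ and asymptotically stable for all $\sigma\in\mathcal S'[\tau_{1,2}(\eta),\eta]$.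
   Context: Planar switched system: $\dot x(t)=A_{\sigma(t)}x(t)$, $x(t)\in\mathbb R^2$ continuous in $t\ge0$, with $A_1,A_2$ real $2\times2$ matrices. A switching signal $\sigma:[0,\infty)\to\{1,2\}$ is right-continuous and piecewise constant with infinitely many discontinuities $0<d_1<d_2<\cdots$, $d_k\to\infty$; set $d_0=0$. For a signal with $\sigma(0)=1$ put $t_k=d_{2k-1}-d_{2k-2}$ (times spent in $A_1$) and $s_k=d_{2k}-d_{2k-1}$ (times spent in $A_2$), $k\ge1$. For $\tau,\eta>0$, $\mathcal S[\tau,\eta]$ is the set of signals with $\sigma(0)=1$, $t_k\ge\tau$ and $s_k\le\eta$ for all $k\in\mathbb N$; $\mathcal S'[\tau,\eta]$ is the set of $\sigma\in\mathcal S[\tau,\eta]$ for which the sequence $(t_k,s_k)_{k\ge1}$ does not converge to $(\tau,\eta)$. For a given signal $\sigma$, the system is stable if for every $\varepsilon'>0$ there is $\delta>0$ such that $\|x(0)\|<\delta$ implies $\|x(t)\|<\varepsilon'$ for all $t>0$; it is asymptotically stable if it is stable and $\|x(t)\|\to0$ as $t\to\infty$ for every $x(0)\in\mathbb R^2$. Norms are Euclidean. *)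

(* Defs.v *)
From HB Require Import structures.
From mathcomp Require Import all_boot all_order all_algebra.
From mathcomp Require Import ring lra.
From mathcomp Require Import all_classical all_reals all_analysis.

Set Implicit Arguments.
Unset Strict Implicit.
Unset Printing Implicit Defensive.

Import Order.TTheory GRing.Theory Num.Theory.
Import numFieldNormedType.Exports.

Local Open Scope classical_set_scope.
Local Open Scope ring_scope.

Definition sinh (R : realType) (x : R) : R := (expR x - expR (- x)) / 2.

Definition asinh (R : realType) (x : R) : R := ln (x + Num.sqrt (x ^+ 2 + 1)).

Lemma asinh_arg_gt0 (R : realType) (x : R) : 0 < x + Num.sqrt (x ^+ 2 + 1).
Proof.
suff : - x < Num.sqrt (x ^+ 2 + 1) by rewrite -subr_gt0 opprK addrC.
apply: le_lt_trans (ler_norm _) _; rewrite normrN -sqrtr_sqr ltr_sqrt.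
  by rewrite ltrDl.
by rewrite ltr_pwDr// sqr_ge0.
Qed.

Lemma asinhK (R : realType) : cancel (@asinh R) (@sinh R).
Proof.
move=> x; rewrite /sinh /asinh expRN lnK ?posrE ?asinh_arg_gt0//.
have := asinh_arg_gt0 x.
have : Num.sqrt (x ^+ 2 + 1) ^+ 2 = x ^+ 2 + 1 by rewrite sqr_sqrtr ?addr_ge0 ?sqr_ge0.
move: (Num.sqrt _) => s hs s_gt0.
have -> : (x + s)^-1 = s - x.
  apply: (mulfI (lt0r_neq0 s_gt0)); rewrite divff ?lt0r_neq0//.
  have -> : (x + s) * (s - x) = s ^+ 2 - x ^+ 2 by ring.
  by rewrite hs; ring.
by field.
Qed.

Lemma sinhK (R : realType) : cancel (@sinh R) (@asinh R).
Proof.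
move=> x; rewrite /sinh /asinh.
have h : expR x * expR (- x) = 1 by rewrite -expRD subrr expR0.
have -> : ((expR x - expR (- x)) / 2) ^+ 2 + 1
          = ((expR x + expR (- x)) / 2) ^+ 2.
  by rewrite -[X in _ + X]h; field.
rewrite sqrtr_sqr ger0_norm ?divr_ge0 ?addr_ge0 ?expR_ge0//.
have -> : (expR x - expR (- x)) / 2 + (expR x + expR (- x)) / 2 = expR x.
  by field.
exact: expRK.
Qed.

(* The matrix with rows (a, b) and (c, d). *)
Definition mx2 (R : realType) (a b c d : R) : 'M[R]_2 :=
  \matrix_(i < 2, j < 2)
    if i == 0 then (if j == 0 then a else b) else (if j == 0 then c else d).

(* The library norm on matrices is the sup norm. *)
Definition enorm (R : realType) (n : nat) (v : 'cV[R]_n) : R :=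
  Num.sqrt (\sum_(i < n) v i 0 ^+ 2).

Inductive mode := mode1 | mode2.

(* [switch_time] lists 0 followed by the discontinuities of the signal, so it
   is determined by the values of the signal on [0, +oo[. Values at negative
   times are junk. *)
Record switching_signal (R : realType) := SwitchingSignal {
  signal_val :> R -> mode;
  switch_time : nat -> R;
  switch_time0 : switch_time 0 = 0;
  switch_time_lt : forall k, switch_time k < switch_time k.+1;
  switch_time_cvg : switch_time @ \oo --> +oo;
  signal_const : forall k t, switch_time k <= t < switch_time k.+1 ->
    signal_val t = signal_val (switch_time k);
  signal_jump : forall k,
    signal_val (switch_time k.+1) <> signal_val (switch_time k) }.

(* For a signal starting in [mode1], the lengths t_(k+1) and s_(k+1) of the
   successive stays in [mode1] and [mode2]: indices are shifted by one. *)
Definition stay1 (R : realType) (sigma : switching_signal R) (k : nat) : R :=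
  switch_time sigma (2 * k).+1 - switch_time sigma (2 * k).

Definition stay2 (R : realType) (sigma : switching_signal R) (k : nat) : R :=
  switch_time sigma (2 * k).+2 - switch_time sigma (2 * k).+1.

Definition dwell_flee (R : realType) (tau eta : R) : set (switching_signal R) :=
  [set sigma : switching_signal R | sigma 0 = mode1 /\
    forall k, tau <= stay1 sigma k /\ stay2 sigma k <= eta].

Definition dwell_flee' (R : realType) (tau eta : R) : set (switching_signal R) :=
  [set sigma : switching_signal R | dwell_flee tau eta sigma /\
    ~ ((stay1 sigma k, stay2 sigma k) @[k --> \oo] --> (tau, eta))].

Definition subsystem (R : realType) (A1 A2 : 'M[R]_2) (m : mode) : 'M[R]_2 :=
  match m with mode1 => A1 | mode2 => A2 end.

(* The trajectory is continuous on [0, +oo[ and solves the equation between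
   switching times; only its values at nonnegative times matter. *)
Definition is_trajectory (R : realType) (A1 A2 : 'M[R]_2)
    (sigma : switching_signal R) (x : R -> 'cV[R]_2) : Prop :=
  {within `[0, +oo[, continuous x} /\
  forall k t, switch_time sigma k < t < switch_time sigma k.+1 ->
    is_derive t 1 x (subsystem A1 A2 (sigma t) *m x t).

Definition stable (R : realType) (A1 A2 : 'M[R]_2)
    (sigma : switching_signal R) : Prop :=
  forall eps : R, 0 < eps -> exists2 delta : R, 0 < delta &
    forall x, is_trajectory A1 A2 sigma x -> enorm (x 0) < delta ->
      forall t, 0 < t -> enorm (x t) < eps.

Definition asymptotically_stable (R : realType) (A1 A2 : 'M[R]_2)
    (sigma : switching_signal R) : Prop :=
  stable A1 A2 sigma /\
  forall x, is_trajectory A1 A2 sigma x -> enorm (x t) @[t --> +oo] --> 0.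

Definition tau12 (R : realType) (alpha1 n2 c d eta : R) : R :=
  n2 / alpha1 * eta + alpha1^-1 * asinh ((c ^+ 2 + d ^+ 2) / 2 * eta).

(* Main.v *)
Require Import Defs.
From mathcomp Require Import all_boot all_order all_algebra.
From mathcomp Require Import ring lra.
From mathcomp Require Import all_classical all_reals all_analysis.

(** A change of coordinates puts both subsystems in one picture. In the
    coordinates y = P1^-1 x, the first subsystem is a rotation times a decay, so
    that the Euclidean norm shrinks by exactly exp(- alpha1 t) during a stay of
    length t. A further change of coordinates that is orthogonal up to a factor
    keeps this property. It is chosen so that its first coordinate is
    c y1 + d y2, the second coordinate of M y, which the second subsystem only
    scales; the latter then has the matrix with rows (n2, 0) and (k, n2), where
    |k| = c^2 + d^2 ([shear_normal_form]).

    The flow of that matrix for a time s is exp(n2 s) times a shear of slope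
    k s. A shear of slope m has determinant 1 and squared Frobenius norm
    2 + m^2, so its largest singular value e satisfies e - 1/e = |m|, that is,
    e = exp(asinh(|m|/2)) ([shear_norm_le]). Hence a stay of length s in the
    second mode multiplies the norm by at most
    exp(n2 s + asinh((c^2 + d^2) s / 2)) ([shear_flow_enorm]), whose exponent
    is [flee_growth].

    The dwell time tau12 is the value for which alpha1 tau12 equals the growth
    exponent of a second stay of length eta. A cycle with t >= tau12 and
    s <= eta therefore multiplies the norm by at most exp(- gap), with
    gap = alpha1 t - (growth exponent of s) >= 0. The norms at the starts of
    the cycles do not increase, and inside a cycle the norm exceeds its value
    at the start by a bounded factor only: this is stability.

    If those norms had a positive limit, the ratios of successive ones would
    tend to 1 and the gaps to 0 ([contraction_cvg0]). A gap is the sum of the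
    two nonnegative terms alpha1 (t - tau12) and
    (growth of eta) - (growth of s), and the growth exponent is strictly
    increasing; so the gaps tend to 0 only if (t, s) tends to (tau12, eta)
    ([gap_cvg0]). When (t, s) does not, the norms tend to 0. *)

Import Order.TTheory GRing.Theory Num.Theory.
Import numFieldNormedType.Exports.

Local Open Scope classical_set_scope.
Local Open Scope ring_scope.

Set Implicit Arguments.
Unset Strict Implicit.
Unset Printing Implicit Defensive.

(** * Inverse hyperbolic sine and the norm of a planar shear *)

Lemma asinh_lt (R : realType) (x y : R) : x < y -> asinh x < asinh y.
Proof.
have sinh_le (u v : R) : u <= v -> sinh u <= sinh v.
  move=> uv; rewrite /sinh ler_pM2r ?invr_gt0//.
  by apply: lerB; rewrite ler_expR// lerN2.
by rewrite !ltNge => /negP xy; apply/negP => /sinh_le; rewrite !asinhK => /xy.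
Qed.

Lemma expR_asinh (R : realType) (x : R) :
  expR (asinh x) - (expR (asinh x))^-1 = 2 * x.
Proof. by rewrite -{3}[x]asinhK /sinh expRN; field; rewrite lt0r_neq0 ?expR_gt0. Qed.

(** With e = exp(asinh(|m|/2)), so that e - 1/e = |m|, the difference of the
    two sides is m / e times the square of p - e r when m >= 0; the sign of m
    is absorbed by that of r. *)
Lemma shear_norm_le (R : realType) (m p r : R) :
  p ^+ 2 + (r + m * p) ^+ 2
    <= expR (2 * asinh (`|m| / 2)) * (p ^+ 2 + r ^+ 2).
Proof.
wlog m_ge0 : m r / 0 <= m.
  move=> H; case: (leP 0 m) => [|/ltW m_le0]; first exact: H.
  have := H (- m) (- r); rewrite oppr_ge0 normrN => /(_ m_le0).
  by rewrite mulNr -opprD !sqrrN.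
rewrite ger0_norm// expRM_natl.
have := expR_asinh (m / 2); have := expR_gt0 (asinh (m / 2)).
move: (expR _) => e e_gt0; rewrite (_ : 2 * (m / 2) = m); last by field.
move=> em; rewrite -subr_ge0.
suff -> : e ^+ 2 * (p ^+ 2 + r ^+ 2) - (p ^+ 2 + (r + m * p) ^+ 2)
          = m / e * (p - e * r) ^+ 2.
  by rewrite mulr_ge0 ?sqr_ge0// divr_ge0// ltW.
by rewrite -em; field; exact: lt0r_neq0.
Qed.

(** Logarithm of the largest factor by which the flow of the matrix with rows
    (n, 0) and (k, n), for k >= 0, can multiply the Euclidean norm in time s >= 0. *)
Definition flee_growth (R : realType) (n k s : R) : R :=
  n * s + asinh (k / 2 * s).

Lemma flee_growth_lt (R : realType) (n k s s' : R) : 0 <= n -> 0 < k ->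
  s < s' -> flee_growth n k s < flee_growth n k s'.
Proof.
move=> n0 k0 ss'; apply: ler_ltD; first by rewrite ler_wpM2l// ltW.
by apply: asinh_lt; rewrite ltr_pM2l// divr_gt0.
Qed.

Lemma flee_growth_le (R : realType) (n k s s' : R) : 0 <= n -> 0 < k ->
  s <= s' -> flee_growth n k s <= flee_growth n k s'.
Proof.
move=> n0 k0; rewrite le_eqVlt => /predU1P[->//|ss'].
by apply/ltW/flee_growth_lt.
Qed.

Lemma flee_growth0 (R : realType) (n k : R) : flee_growth n k 0 = 0.
Proof.
by rewrite /flee_growth !mulr0 add0r /asinh expr0n/= !add0r sqrtr1 ln1.
Qed.

(** * Euclidean norm in the plane *)

Lemma enorm_sqr (R : realType) (v : 'cV[R]_2) :
  enorm v ^+ 2 = v 0 0 ^+ 2 + v 1 0 ^+ 2.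
Proof.
rewrite /enorm sqr_sqrtr; last by apply: sumr_ge0 => i _; exact: sqr_ge0.
by rewrite !big_ord_recl big_ord0 addr0 (_ : lift ord0 ord0 = 1)//; exact/val_inj.
Qed.

Lemma enorm_ge0 (R : realType) n (v : 'cV[R]_n) : 0 <= enorm v.
Proof. exact: sqrtr_ge0. Qed.

Lemma enorm_le_scaled (R : realType) (c : R) (v w : 'cV[R]_2) : 0 <= c ->
  v 0 0 ^+ 2 + v 1 0 ^+ 2 <= c ^+ 2 * (w 0 0 ^+ 2 + w 1 0 ^+ 2) ->
  enorm v <= c * enorm w.
Proof.
by move=> c0; rewrite -!enorm_sqr -exprMn ler_sqr ?nnegrE ?mulr_ge0 ?enorm_ge0.
Qed.

Lemma mulmx2E (R : realType) n (T : 'M[R]_(n, 2)) (v : 'cV[R]_2) i :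
  (T *m v) i 0 = T i 0 * v 0 0 + T i 1 * v 1 0.
Proof.
rewrite mxE !big_ord_recl big_ord0 addr0 (_ : lift ord0 ord0 = 1)//.
exact/val_inj.
Qed.

(** The Frobenius norm of T would do, by the Cauchy-Schwarz inequality; one
    plus its square avoids a square root and is positive even if T = 0. *)
Lemma mulmx_enorm_bound (R : realType) (T : 'M[R]_2) :
  exists2 C : R, 0 < C & forall v, enorm (T *m v) <= C * enorm v.
Proof.
pose S := T 0 0 ^+ 2 + T 0 1 ^+ 2 + T 1 0 ^+ 2 + T 1 1 ^+ 2.
have S0 : 0 <= S by rewrite !addr_ge0 ?sqr_ge0.
exists (1 + S); first by rewrite ltr_pwDl.
move=> v; apply: enorm_le_scaled; first by rewrite addr_ge0.
rewrite !mulmx2E.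
apply: (@le_trans _ _ (S * (v 0 0 ^+ 2 + v 1 0 ^+ 2))).
  rewrite /S -subr_ge0.
  move: (T 0 0) (T 0 1) (T 1 0) (T 1 1) (v 0 0) (v 1 0) => t1 t2 t3 t4 x y.
  rewrite (_ : _ - _ = (t1 * y - t2 * x) ^+ 2 + (t3 * y - t4 * x) ^+ 2).
    by rewrite addr_ge0 ?sqr_ge0.
  by ring.
by rewrite ler_wpM2r ?addr_ge0 ?sqr_ge0//; nra.
Qed.

(** * Derivatives and continuity of matrix-valued functions *)

Lemma derive0_segment_cst (R : realType) (f : R -> R) (a b : R) :
  {within `[a, b], continuous f} ->
  (forall t, a < t < b -> is_derive t 1 f 0) ->
  forall t, a <= t <= b -> f t = f a.
Proof.
move=> cf df t /andP[at_ tb].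
have [| |c _] := @MVT_segment R f (fun=> 0) a t at_.
- move=> s; rewrite in_itv/= => /andP[as_ st].
  by apply: df; rewrite as_ (lt_le_trans st).
- apply: continuous_subspaceW cf => s /=; rewrite !in_itv/=.
  by move=> /andP[-> /le_trans]; apply.
- by rewrite mul0r => /eqP; rewrite subr_eq0 => /eqP.
Qed.

(** Difference quotients commute with f, and continuity of f passes to the
    limit; this is the chain rule without differentiability of f. *)
Lemma is_derive_linear (R : numFieldType) (U V W : normedModType R)
    (f : {linear V -> W}) (g : U -> V) (a v : U) (dg : V) :
  continuous f -> is_derive a v g dg -> is_derive a v (f \o g) (f dg).
Proof.
move=> cf [/cvg_ex[l gl] gdg].
have ldg : l = dg by rewrite -gdg; apply/esym/cvg_lim.
suff fl : (fun h => h^-1 *: (((f \o g) \o shift a) (h *: v) - (f \o g) a))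
            @ 0^' --> f dg.
  by split; [apply/cvg_ex; exists (f dg)|exact/cvg_lim].
rewrite -ldg (_ : (fun h => _) =
  f \o (fun h => h^-1 *: ((g \o shift a) (h *: v) - g a))).
  by apply: continuous_cvg gl; exact: cf.
by apply/funext => h /=; rewrite linearZ (linearB f).
Qed.

(** The product is a combination of the fixed columns of T, with coefficients
    the coordinates of v. *)
Lemma mulmx_continuous (R : realFieldType) (m n : nat) (T : 'M[R]_(m, n)) :
  continuous (fun v : 'cV[R]_n => T *m v).
Proof.
have -> : (fun v : 'cV[R]_n => T *m v) = (fun v => \sum_k v k 0 *: col k T).
  apply/funext => v; apply/matrixP => i j; rewrite summxE !mxE.
  by apply: eq_bigr => k _; rewrite !mxE mulrC (ord1 j).
apply: continuous_big => [|k _]; first exact: add_continuous.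
move=> v; apply: (@cvgZr_tmp R _ _ (nbhs v) _ (fun v : 'cV[R]_n => v k 0)).
exact: coord_continuous.
Qed.

Lemma is_derive_coord (R : realFieldType) (V : normedModType R) (m n : nat)
    (M : V -> 'M[R]_(m, n)) (dM : 'M[R]_(m, n)) (t v : V) i j :
  is_derive t v M dM -> is_derive t v (fun s => M s i j) (dM i j).
Proof.
move=> [/[dup] /derivable_mxP Mt dMt <-]; split; first exact: Mt.
by rewrite derive_mx// mxE.
Qed.

Lemma is_derive_expRM (R : realType) (k t : R) :
  is_derive t 1 (fun s => expR (k * s)) (k * expR (k * t)).
Proof.
have h : is_derive t 1 (k \*: id : R -> R) (k * 1) by exact: is_deriveZ.
rewrite mulrC -[X in _ * X]mulr1.
exact: (@is_derive1_comp _ expR (k \*: id : R -> R)).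
Qed.

Lemma continuous_expRM (R : realType) (k : R) :
  continuous (fun s => expR (k * s)).
Proof.
move=> t; apply/differentiable_continuous/derivable1_diffP.
exact: (@ex_derive _ _ _ _ _ _ _ (is_derive_expRM k t)).
Qed.

Lemma within_coord_continuous (R : realFieldType) m n (D : set R)
    (M : R -> 'M[R]_(m, n)) i j :
  {within D, continuous M} -> {within D, continuous (fun s => M s i j)}.
Proof.
move=> cM s.
exact: (cvg_comp M (fun A => A i j) (cM s) (@coord_continuous _ _ _ i j (M s))).
Qed.

(** * Flows of the two normal forms *)

(** The rotation part is skew-symmetric, so it does not contribute to the
    derivative of the squared norm, and exp(2 alpha s) times the squared norm
    is constant. *)
Lemma spiral_enorm (R : realType) (alpha beta a b : R) (z : R -> 'cV[R]_2) :
  {within `[a, b], continuous z} ->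
  (forall t, a < t < b ->
    is_derive t 1 z (mx2 (- alpha) (- beta) beta (- alpha) *m z t)) ->
  forall t, a <= t <= b -> enorm (z t) = expR (- alpha * (t - a)) * enorm (z a).
Proof.
move=> cz dz t tab.
pose f s := expR (2 * alpha * s) * (z s 0 0 ^+ 2 + z s 1 0 ^+ 2).
have cc (i : 'I_2) := @within_coord_continuous _ _ _ _ z i 0 cz.
have fE : f t = f a.
  apply: (derive0_segment_cst (f := f)) tab.
  - move=> s; apply: cvgM.
      exact: (continuous_subspaceT (@continuous_expRM _ (2 * alpha))).
    by apply: cvgD; rewrite expr2; apply: cvgM; exact: cc.
  - move=> s /dz zs.
    have z0 := is_derive_coord 0 0 zs.
    have z1 := is_derive_coord 1 0 zs.
    rewrite !mulmx2E !mxE/= in z0 z1.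
    have e := is_derive_expRM (2 * alpha) s.
    apply: (is_derive_eq
      (is_deriveM e (is_deriveD (is_deriveX 2 z0) (is_deriveX 2 z1)))).
    by rewrite !fctE /GRing.scale/=; ring.
have : enorm (z t) ^+ 2 = (expR (- alpha * (t - a)) * enorm (z a)) ^+ 2.
  rewrite exprMn -expRM_natl !enorm_sqr.
  have e0 := expR_gt0 (2 * alpha * t).
  apply: (mulfI (lt0r_neq0 e0)); rewrite -/(f t) fE /f mulrA -expRD.
  by congr (expR _ * _); ring.
by move/eqP; rewrite eqrXn2 ?mulr_ge0 ?expR_ge0 ?enorm_ge0// => /eqP.
Qed.

(** The system is solved by two first integrals: exp(-n s) times the first
    coordinate is constant, and then exp(-n s) times the second coordinate is
    affine in s. The solution is exp(n (t - a)) times a shear of slope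
    k (t - a), to which the bound on shears applies. *)
Lemma shear_flow_enorm (R : realType) (n k a b : R) (z : R -> 'cV[R]_2) :
  {within `[a, b], continuous z} ->
  (forall t, a < t < b -> is_derive t 1 z (mx2 n 0 k n *m z t)) ->
  forall t, a <= t <= b ->
  enorm (z t) <= expR (flee_growth n `|k| (t - a)) * enorm (z a).
Proof.
move=> cz dz t tab.
have cc (i : 'I_2) := @within_coord_continuous _ _ _ _ z i 0 cz.
pose g (i : 'I_2) s := expR (- n * s) * z s i 0.
have cg i : {within `[a, b], continuous (g i)}.
  move=> s; apply: cvgM; last exact: cc.
  exact: (continuous_subspaceT (@continuous_expRM _ (- n))).
have g0 : forall s, a <= s <= b -> g 0 s = g 0 a.
  apply: derive0_segment_cst => // s /dz/(is_derive_coord 0 0).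
  rewrite mulmx2E !mxE/= mul0r addr0 => z0.
  apply: (is_derive_eq (is_deriveM (is_derive_expRM (- n) s) z0)).
  by rewrite /GRing.scale/=; ring.
(* By g0, the constant k * g 0 a is the derivative of g 1. *)
pose h s := g 1 s - k * g 0 a * s.
have h1 : forall s, a <= s <= b -> h s = h a.
  apply: derive0_segment_cst => [s|s sab].
    apply: cvgB; first exact: cg.
    exact: (continuous_subspaceT (@mulrl_continuous _ (k * g 0 a))).
  have /g0 g0s : a <= s <= b by case/andP: sab => /ltW -> /ltW ->.
  move: sab => /dz/(is_derive_coord 1 0); rewrite mulmx2E !mxE/= => z1.
  have l : is_derive s 1 (k * g 0 a \*: id : R -> R) (k * g 0 a * 1).
    exact: is_deriveZ.
  apply: (is_derive_eq
    (is_deriveB (is_deriveM (is_derive_expRM (- n) s) z1) l)).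
  by rewrite /GRing.scale/= -g0s /g; ring.
have en s : expR (- n * s) = (expR (n * s))^-1 by rewrite mulNr expRN.
have ent : expR (n * t) != 0 by rewrite lt0r_neq0 ?expR_gt0.
have ena : expR (n * a) != 0 by rewrite lt0r_neq0 ?expR_gt0.
have eD : expR (n * (t - a)) = expR (n * t) / expR (n * a).
  by rewrite mulrBr expRD expRN.
have pE : z t 0 0 = expR (n * (t - a)) * z a 0 0.
  have := g0 _ tab; rewrite /g !en => /(canRL (mulKf _)) ->; rewrite ?invr_eq0//.
  by rewrite eD; field; rewrite ena ent.
have rE : z t 1 0
    = expR (n * (t - a)) * (z a 1 0 + k * (t - a) * z a 0 0).
  have := h1 _ tab; rewrite /h /g => /(canRL (subrK _)).
  rewrite !en => /(canRL (mulKf _)) ->; rewrite ?invr_eq0//.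
  by rewrite eD; field; rewrite ena ent.
have ta : `|t - a| = t - a by rewrite ger0_norm// subr_ge0; case/andP: tab.
apply: enorm_le_scaled; first exact: expR_ge0.
rewrite /flee_growth.
rewrite (_ : `|k| / 2 * (t - a) = `|k * (t - a)| / 2); last first.
  by rewrite normrM ta mulrAC.
rewrite expRD exprMn -(expRM_natl 2 (asinh _)).
rewrite pE rE !exprMn -mulrDr -(mulrA (_ ^+ 2)) ler_wpM2l ?sqr_ge0//.
exact: shear_norm_le.
Qed.

(** * Sequences *)

(** The least index j with t < u (K + j) is positive, and its predecessor
    gives the index sought. *)
Lemma cvgny_locate (R : realType) (u : nat -> R) (K : nat) (t : R) :
  u @ \oo --> +oo -> u K <= t ->
  exists2 k, (K <= k)%N & u k <= t < u k.+1.
Proof.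
move=> /cvgryPgt/(_ t)[N _ uN] uKt.
have ex : exists j, t < u (K + j)%N by exists N; apply: uN; exact: leq_addl.
case: (ex_minnP ex) => -[|j]; first by rewrite addn0 ltNge uKt.
move=> tj jmin; exists (K + j)%N; first exact: leq_addr.
rewrite -addnS tj andbT leNgt; apply/negP => /jmin.
by rewrite ltnn.
Qed.

(** The sequence v is nonincreasing, hence convergent. If its limit is
    positive, then g k is squeezed between 0 and ln (v k) - ln (v (k + 1)),
    which tends to 0. *)
Lemma contraction_cvg0 (R : realType) (v g : nat -> R) :
  (forall k, 0 <= v k) -> (forall k, 0 <= g k) ->
  (forall k, v k.+1 <= expR (- g k) * v k) ->
  ~ (g @ \oo --> 0) -> v @ \oo --> 0.
Proof.
move=> v0 g0 vS ng.
have vdec : nonincreasing_seq v.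
  apply/nonincreasing_seqP => k; apply: le_trans (vS k) _.
  by rewrite ler_piMl// -expR0 ler_expR oppr_le0.
have vcvg : cvgn v.
  by apply: nonincreasing_is_cvgn vdec _; exists 0 => _ [k _ <-].
have : 0 <= limn v by apply: limr_ge => //; exact: nearW.
rewrite le_eqVlt => /predU1P[l0|l_gt0]; first by move: vcvg; rewrite -l0.
have v_gt0 k : 0 < v k.
  by apply: lt_le_trans l_gt0 _; exact: nonincreasing_cvgn_ge.
exfalso; apply: ng.
have lnv : ln (v k) @[k --> \oo] --> ln (limn v).
  exact: (cvg_comp _ _ vcvg (continuous_ln l_gt0)).
apply: (@squeeze_cvgr _ _ _ _ (fun=> 0) (fun k => ln (v k) - ln (v k.+1))).
- apply: nearW => k; rewrite g0/=.
  have : ln (v k.+1) <= ln (expR (- g k) * v k).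
    by rewrite ler_ln ?posrE ?mulr_gt0 ?expR_gt0.
  by rewrite lnM ?posrE ?expR_gt0// expRK; lra.
- exact: (@cvg_cst _ _ _ \oo).
- rewrite -(subrr (ln (limn v))); apply: cvgB => //.
  by rewrite -(cvg_shiftS (fun k => ln (v k))) in lnv.
Qed.

(** The hypothesis on tau makes the gap a sum of two nonnegative terms, one
    in t and one in s, so both tend to 0. For s, strict monotonicity of the
    growth exponent replaces an explicit modulus: s <= eta - e would keep the
    second term above a fixed positive constant. *)
Lemma gap_cvg0 (R : realType) (alpha n k tau eta : R) (t s : nat -> R) :
  0 < alpha -> 0 <= n -> 0 < k -> alpha * tau = flee_growth n k eta ->
  (forall i, tau <= t i /\ s i <= eta) ->
  (fun i => alpha * t i - flee_growth n k (s i)) @ \oo --> 0 ->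
  (t i, s i) @[i --> \oo] --> (tau, eta).
Proof.
move=> alpha0 n0 k0 taueta ts gap0.
have gapE i : alpha * t i - flee_growth n k (s i) =
    alpha * (t i - tau) + (flee_growth n k eta - flee_growth n k (s i)).
  by rewrite -taueta; ring.
have t0 i : 0 <= alpha * (t i - tau).
  by rewrite mulr_ge0 ?subr_ge0 ?(ltW alpha0)//; case: (ts i).
have s0 i : 0 <= flee_growth n k eta - flee_growth n k (s i).
  by rewrite subr_ge0; apply: flee_growth_le => //; case: (ts i).
have gap_lt e : 0 < e ->
    \forall i \near \oo, alpha * t i - flee_growth n k (s i) < e.
  by move=> e0; apply: cvgr_lt gap0 _ _.
apply: (@cvg_pair _ _ _ \oo (nbhs tau) (nbhs eta)); apply/cvgrPdistC_lt => e e0.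
- near=> i.
  rewrite ger0_norm; last by rewrite subr_ge0; case: (ts i).
  rewrite -(ltr_pM2l alpha0).
  apply: (@le_lt_trans _ _ (alpha * t i - flee_growth n k (s i))).
    by rewrite gapE lerDl.
  by near: i; exact: gap_lt (mulr_gt0 alpha0 e0).
- have e1 : 0 < flee_growth n k eta - flee_growth n k (eta - e).
    by rewrite subr_gt0 flee_growth_lt// ltrBlDr ltrDl.
  near=> i.
  rewrite ler0_norm ?opprB; last by rewrite subr_le0; case: (ts i).
  rewrite ltNge; apply/negP => H.
  have : flee_growth n k (s i) <= flee_growth n k (eta - e).
    by apply: flee_growth_le => //; lra.
  have : alpha * t i - flee_growth n k (s i)
         < flee_growth n k eta - flee_growth n k (eta - e).
    by near: i; exact: gap_lt.
  by have := t0 i; rewrite gapE; lra.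
Unshelve. all: by end_near. Qed.

(** * Invariance under a linear change of coordinates *)

Lemma trajectory_conj (R : realType) (A1 A2 B1 B2 T : 'M[R]_2)
    (sigma : switching_signal R) (x : R -> 'cV[R]_2) :
  T *m A1 = B1 *m T -> T *m A2 = B2 *m T ->
  is_trajectory A1 A2 sigma x -> is_trajectory B1 B2 sigma (fun t => T *m x t).
Proof.
move=> TA1 TA2 [cx dx]; split.
  by move=> t; exact: (cvg_comp _ _ (cx t) (@mulmx_continuous _ _ _ T (x t))).
move=> k t /dx xt.
have -> : subsystem B1 B2 (sigma t) *m (T *m x t)
        = T *m (subsystem A1 A2 (sigma t) *m x t).
  by rewrite !mulmxA; case: (sigma t); rewrite /= ?TA1 ?TA2.
exact: (is_derive_linear (@mulmx_continuous _ _ _ T) xt).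
Qed.

Lemma stable_conj (R : realType) (A1 A2 B1 B2 T : 'M[R]_2)
    (sigma : switching_signal R) : T \in unitmx ->
  T *m A1 = B1 *m T -> T *m A2 = B2 *m T ->
  stable B1 B2 sigma -> stable A1 A2 sigma.
Proof.
move=> uT TA1 TA2 stB eps eps0.
have [C C0 TC] := mulmx_enorm_bound T.
have [C' C'0 TC'] := mulmx_enorm_bound (invmx T).
have [delta delta0 H] := stB _ (divr_gt0 eps0 C'0).
exists (delta / C); first exact: divr_gt0.
move=> x /(trajectory_conj TA1 TA2) tx x0 t t0.
rewrite -[x t](mulKmx uT); apply: le_lt_trans (TC' _) _.
rewrite mulrC -ltr_pdivlMr//; apply: H tx _ _ t0.
by apply: le_lt_trans (TC _) _; rewrite mulrC -ltr_pdivlMr.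
Qed.

Lemma asymptotically_stable_conj (R : realType) (A1 A2 B1 B2 T : 'M[R]_2)
    (sigma : switching_signal R) : T \in unitmx ->
  T *m A1 = B1 *m T -> T *m A2 = B2 *m T ->
  asymptotically_stable B1 B2 sigma -> asymptotically_stable A1 A2 sigma.
Proof.
move=> uT TA1 TA2 [stB asB]; split; first exact: (stable_conj uT TA1 TA2).
move=> x /(trajectory_conj TA1 TA2)/asB Tx0.
have [C C0 TC] := mulmx_enorm_bound (invmx T).
apply: (@squeeze_cvgr _ _ _ _ (fun=> 0) (fun t => C * enorm (T *m x t))).
- by apply: nearW => t; have := TC (T *m x t); rewrite mulKmx// enorm_ge0.
- exact: (@cvg_cst _ _ _ (pinfty_nbhs R)).
- rewrite -(mulr0 C); apply: cvgM => //.
  exact: (@cvg_cst _ _ _ (pinfty_nbhs R)).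
Qed.

(** * One cycle of a switching signal *)

Lemma cycle_modes (R : realType) (sigma : switching_signal R) :
  sigma 0 = mode1 -> forall k,
  sigma (switch_time sigma (2 * k)) = mode1 /\
  sigma (switch_time sigma (2 * k).+1) = mode2.
Proof.
move=> s0.
have other i m : sigma (switch_time sigma i) = m ->
    sigma (switch_time sigma i.+1) = if m is mode1 then mode2 else mode1.
  move=> sm; have := @signal_jump _ sigma i; rewrite sm.
  by case: m {sm}; case: (sigma _).
elim=> [|k [_ /other IH]].
  have h0 : sigma (switch_time sigma (2 * 0)) = mode1.
    by rewrite muln0 switch_time0.
  by split=> //; exact: other h0.
by rewrite mulnS !addSn add0n; split=> //; exact: other IH.
Qed.

(** Isolates the only facts about a trajectory that one stay uses: a single
    linear equation on an open interval, with continuity up to its ends. *)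
Lemma stay_trajectory (R : realType) (A1 A2 : 'M[R]_2)
    (sigma : switching_signal R) (x : R -> 'cV[R]_2) k m :
  is_trajectory A1 A2 sigma x -> sigma (switch_time sigma k) = m ->
  {within `[switch_time sigma k, switch_time sigma k.+1], continuous x} /\
  forall t, switch_time sigma k < t < switch_time sigma k.+1 ->
    is_derive t 1 x (subsystem A1 A2 m *m x t).
Proof.
move=> [cx dx] sm; split.
  apply: continuous_subspaceW cx => t /=; rewrite !in_itv/= andbT.
  case/andP => + _; apply: le_trans.
  elim: k {sm} => [|k IH]; first by rewrite switch_time0.
  by apply: le_trans IH _; exact/ltW/switch_time_lt.
move=> t tk; have := dx _ _ tk.
rewrite (@signal_const _ sigma k) ?sm//.
by case/andP: tk => /ltW -> ->.
Qed.

(** The first stay can only shrink the norm. Inside the cycle this and the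
    monotonicity of the growth exponent give the uniform factor; at its end
    the exact decay and the growth combine into the gap. *)
Lemma cycle_bound (R : realType) (alpha beta n k tau eta : R)
    (sigma : switching_signal R) (z : R -> 'cV[R]_2) :
  0 < alpha -> 0 <= n -> k != 0 -> 0 < eta ->
  alpha * tau = flee_growth n `|k| eta ->
  dwell_flee tau eta sigma ->
  is_trajectory (mx2 (- alpha) (- beta) beta (- alpha)) (mx2 n 0 k n) sigma z ->
  forall i,
  (forall t, switch_time sigma (2 * i) <= t <= switch_time sigma (2 * i).+2 ->
     enorm (z t) <= expR (flee_growth n `|k| eta)
                    * enorm (z (switch_time sigma (2 * i)))) /\
  enorm (z (switch_time sigma (2 * i).+2))
    <= expR (- (alpha * stay1 sigma i - flee_growth n `|k| (stay2 sigma i)))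
       * enorm (z (switch_time sigma (2 * i))).
Proof.
move=> alpha0 n0 k_neq0 eta0 taueta [s0 dwell] tz i.
have k0 : 0 < `|k| by rewrite normr_gt0.
have [m1 m2] := cycle_modes s0 i; have [_ s2] := dwell i.
have [cz1 dz1] := stay_trajectory tz m1.
have [cz2 dz2] := stay_trajectory tz m2.
have d1 := @switch_time_lt _ sigma (2 * i).
have d2 := @switch_time_lt _ sigma (2 * i).+1.
rewrite /stay1; rewrite /stay2 in s2 *.
move: (switch_time sigma (2 * i)) (switch_time sigma (2 * i).+1)
  (switch_time sigma (2 * i).+2) => a b c in d1 d2 s2 cz1 dz1 cz2 dz2 *.
have in1 := spiral_enorm cz1 dz1.
have in2 := shear_flow_enorm cz2 dz2.
have zb : enorm (z b) = expR (- alpha * (b - a)) * enorm (z a).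
  by apply: in1; rewrite (ltW d1) lexx.
split; last first.
  apply: le_trans (in2 c _) _; first by rewrite (ltW d2) lexx.
  rewrite zb mulrA -expRD le_eqVlt; apply/orP; left; apply/eqP.
  by congr (expR _ * _); rewrite /flee_growth; ring.
have growth_ge0 : 0 <= flee_growth n `|k| eta.
  rewrite -(flee_growth0 n `|k|); apply: flee_growth_le => //; exact: ltW.
move=> t /andP[at_ tc]; case: (leP t b) => [tb|/ltW bt].
  rewrite in1 ?at_//; rewrite ler_wpM2r ?enorm_ge0// ler_expR.
  by apply: le_trans growth_ge0; rewrite mulNr oppr_le0 mulr_ge0 ?subr_ge0// ltW.
apply: le_trans (in2 t _) _; first by rewrite bt.
rewrite zb; apply: ler_pM; rewrite ?expR_ge0 ?mulr_ge0 ?expR_ge0 ?enorm_ge0//.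
  rewrite ler_expR; apply: flee_growth_le => //.
  by apply: le_trans s2; rewrite lerD2r.
rewrite ler_piMl ?enorm_ge0// -expR0 ler_expR mulNr oppr_le0.
by rewrite mulr_ge0 ?subr_ge0// ltW.
Qed.

(** * Stability of the normal form *)

Lemma cycle_gap_ge0 (R : realType) (alpha n k tau eta : R)
    (sigma : switching_signal R) :
  0 < alpha -> 0 <= n -> k != 0 ->
  alpha * tau = flee_growth n `|k| eta ->
  dwell_flee tau eta sigma ->
  forall i, 0 <= alpha * stay1 sigma i - flee_growth n `|k| (stay2 sigma i).
Proof.
move=> alpha0 n0 k_neq0 taueta [_ dwell] i; have [t1 s2] := dwell i.
rewrite subr_ge0; apply: (@le_trans _ _ (alpha * tau)); last by rewrite ler_pM2l.
by rewrite taueta; apply: flee_growth_le; rewrite ?normr_gt0.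
Qed.

Lemma cycle_start_cvg (R : realType) (sigma : switching_signal R) :
  (fun i => switch_time sigma (2 * i)) @ \oo --> +oo.
Proof.
apply/cvgryPgt => A; have /cvgryPgt/(_ A)[N _ dN] := @switch_time_cvg _ sigma.
exists N => // i /= Ni; apply: dN => /=; rewrite (leq_trans Ni)//.
exact: leq_pmull.
Qed.

(** Serves for both parts of the theorem: stability takes K = 0, and
    convergence to 0 takes K so large that the norm at the start of cycle K is
    small. *)
Lemma dwell_flee_le_start (R : realType) (alpha beta n k tau eta : R)
    (sigma : switching_signal R) (z : R -> 'cV[R]_2) :
  0 < alpha -> 0 <= n -> k != 0 -> 0 < eta ->
  alpha * tau = flee_growth n `|k| eta ->
  dwell_flee tau eta sigma ->
  is_trajectory (mx2 (- alpha) (- beta) beta (- alpha)) (mx2 n 0 k n) sigma z ->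
  forall K t, switch_time sigma (2 * K) <= t ->
  enorm (z t) <= expR (flee_growth n `|k| eta)
                 * enorm (z (switch_time sigma (2 * K))).
Proof.
move=> alpha0 n0 k_neq0 eta0 taueta dwell tz K t tK.
have cyc := cycle_bound alpha0 n0 k_neq0 eta0 taueta dwell tz.
have [i Ki /andP[it ti]] := cvgny_locate (@cycle_start_cvg _ sigma) tK.
rewrite mulnS !addSn add0n in ti.
apply: le_trans ((cyc i).1 t _) _; first by rewrite it ltW.
rewrite ler_wpM2l ?expR_ge0//.
have dec : nonincreasing_seq (fun j => enorm (z (switch_time sigma (2 * j)))).
  apply/nonincreasing_seqP => j; rewrite mulnS !addSn add0n.
  apply: le_trans (cyc j).2 _; rewrite ler_piMl ?enorm_ge0// -expR0 ler_expR.
  by rewrite oppr_le0; exact: cycle_gap_ge0 dwell _.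
exact: dec.
Qed.

Lemma normal_form_stable (R : realType) (alpha beta n k tau eta : R)
    (sigma : switching_signal R) :
  0 < alpha -> 0 <= n -> k != 0 -> 0 < eta ->
  alpha * tau = flee_growth n `|k| eta ->
  dwell_flee tau eta sigma ->
  stable (mx2 (- alpha) (- beta) beta (- alpha)) (mx2 n 0 k n) sigma.
Proof.
move=> alpha0 n0 k_neq0 eta0 taueta dwell eps eps0.
exists (eps / expR (flee_growth n `|k| eta)).
  by rewrite divr_gt0 ?expR_gt0.
move=> z tz z0 t t0.
have := dwell_flee_le_start alpha0 n0 k_neq0 eta0 taueta dwell tz (K := 0%N) (t := t).
rewrite muln0 switch_time0 => /(_ (ltW t0))/le_lt_trans; apply.
by rewrite mulrC -ltr_pdivlMr ?expR_gt0.
Qed.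

Lemma normal_form_asymptotically_stable (R : realType)
    (alpha beta n k tau eta : R) (sigma : switching_signal R) :
  0 < alpha -> 0 <= n -> k != 0 -> 0 < eta ->
  alpha * tau = flee_growth n `|k| eta ->
  dwell_flee' tau eta sigma ->
  asymptotically_stable
    (mx2 (- alpha) (- beta) beta (- alpha)) (mx2 n 0 k n) sigma.
Proof.
move=> alpha0 n0 k_neq0 eta0 taueta [dwell ncvg].
split; first exact: normal_form_stable dwell.
move=> z tz.
have cyc := cycle_bound alpha0 n0 k_neq0 eta0 taueta dwell tz.
have v0 : enorm (z (switch_time sigma (2 * i))) @[i --> \oo] --> 0.
  apply: (@contraction_cvg0 _ _ (fun i => alpha * stay1 sigma i
                                - flee_growth n `|k| (stay2 sigma i))).
  - by move=> i; exact: enorm_ge0.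
  - exact: cycle_gap_ge0 dwell.
  - by move=> i; rewrite mulnS !addSn add0n; exact: (cyc i).2.
  - move=> gap0; apply: ncvg; case: dwell => _ dwell.
    by apply: gap_cvg0 dwell gap0; rewrite ?normr_gt0.
apply/cvgrPdistC_le => e e0.
have E0 := expR_gt0 (flee_growth n `|k| eta).
have [K _ /(_ K (leqnn K))/= vK] := cvgr_lt _ v0 _ (divr_gt0 e0 E0).
near=> t; rewrite subr0 ger0_norm ?enorm_ge0//.
have tK : switch_time sigma (2 * K) <= t.
  by near: t; apply: nbhs_pinfty_ge; exact: num_real.
apply: le_trans
  (dwell_flee_le_start alpha0 n0 k_neq0 eta0 taueta dwell tz tK) _.
by rewrite mulrC -ler_pdivlMr// ltW.
Unshelve. all: by end_near. Qed.

(** * Reduction to the normal form *)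

Lemma mulmx_mx2 (R : realType) (a b c d a' b' c' d' : R) :
  mx2 a b c d *m mx2 a' b' c' d' =
  mx2 (a * a' + b * c') (a * b' + b * d') (c * a' + d * c') (c * b' + d * d').
Proof.
apply/matrixP => i j; rewrite mxE !big_ord_recl big_ord0 addr0 !mxE/=.
by case: ifP => _; case: ifP.
Qed.

Lemma scalar_mx2 (R : realType) (a : R) : mx2 a 0 0 a = a%:M.
Proof.
apply/matrixP => i j; rewrite !mxE.
by case: i j => [[|[|//]] ?] [[|[|//]] ?]; rewrite /= ?mulr1n ?mulr0n.
Qed.

Lemma det_mx2 (R : realType) (a b c d : R) :
  \det (mx2 a b c d) = a * d - b * c.
Proof.
rewrite (expand_det_row _ 0) !big_ord_recl big_ord0 addr0 /cofactor !det_mx11 !mxE/=.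
by ring.
Qed.

(** Here delta is 1 / (ad - bc), so that L is the inverse of the matrix
    with rows (a, b) and (c, d). The new first coordinate c y1 + d y2 is the
    second coordinate of M y, which the Jordan block only scales, and the new
    second coordinate d y1 - c y2 is orthogonal to it. *)
Lemma shear_normal_form (R : realType) (a b c d n delta : R) (L : 'M[R]_2) :
  delta * (a * d - b * c) = 1 -> L *m mx2 a b c d = 1%:M ->
  mx2 c d d (- c) *m L *m mx2 n 1 0 n *m mx2 a b c d =
  mx2 n 0 (delta * (c ^+ 2 + d ^+ 2)) n *m mx2 c d d (- c).
Proof.
move=> ddet LM.
have -> : L = mx2 (delta * d) (- (delta * b)) (- (delta * c)) (delta * a).
  rewrite -[LHS]mulmx1 -scalar_mx2.
  have <- : mx2 a b c d *m
      mx2 (delta * d) (- (delta * b)) (- (delta * c)) (delta * a) = mx2 1 0 0 1.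
    by rewrite mulmx_mx2 -[in RHS]ddet; congr mx2; ring.
  by rewrite mulmxA LM mul1mx.
rewrite !mulmx_mx2; congr mx2.
- by rewrite -[RHS]mul1r -[in RHS]ddet; ring.
- by rewrite -[RHS]mul1r -[in RHS]ddet; ring.
- by rewrite -[n * d]mul1r -[in RHS]ddet; ring.
- by rewrite -[n * - c]mul1r -[in RHS]ddet; ring.
Qed.

Unset Implicit Arguments.

Theorem theorem9p1 (R : realType) (A1 A2 P1 P2 : 'M[R]_2)
    (alpha1 beta1 n2 a b c d eta : R)
    (halpha1 : 0 < alpha1) (hbeta1 : beta1 <> 0) (hn2 : 0 <= n2)
    (hP1 : P1 \in unitmx) (hP2 : P2 \in unitmx)
    (hA1 : A1 = P1 *m mx2 (- alpha1) beta1 (- beta1) (- alpha1) *m invmx P1)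
    (hA2 : A2 = P2 *m mx2 n2 1 0 n2 *m invmx P2)
    (hM : invmx P2 *m P1 = mx2 a b c d)
    (hdet : \det (mx2 a b c d) = 1 \/ \det (mx2 a b c d) = -1)
    (heta : 0 < eta) :
  (forall sigma : switching_signal R,
     dwell_flee (tau12 alpha1 n2 c d eta) eta sigma ->
     stable A1 A2 sigma) /\
  (forall sigma : switching_signal R,
     dwell_flee' (tau12 alpha1 n2 c d eta) eta sigma ->
     asymptotically_stable A1 A2 sigma).
Proof.
rewrite det_mx2 in hdet; set delta := a * d - b * c in hdet.
have delta2 : delta * delta = 1 by case: hdet => ->; rewrite ?mulrNN mulr1.
have delta1 : `|delta| = 1 by case: hdet => ->; rewrite ?normrN normr1.
pose q := c ^+ 2 + d ^+ 2.
have q_gt0 : 0 < q.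
  rewrite lt_def addr_ge0 ?sqr_ge0// andbT paddr_eq0 ?sqr_ge0// !sqrf_eq0.
  apply/negP => /andP[/eqP c0 /eqP d0].
  move: delta1; rewrite /delta c0 d0 !mulr0 subrr normr0 => /eqP.
  by rewrite eq_sym oner_eq0.
(* As delta is 1 or -1, it is its own inverse: this is the factor
   1 / (ad - bc) of the normal form. *)
pose k := delta * q.
have kE : `|k| = q by rewrite normrM delta1 mul1r gtr0_norm.
have k0 : k != 0 by rewrite -normr_gt0 kE.
(* Q is a reflection times the square root of q, so it preserves the decay of
   the first mode and only reverses the sense of rotation. *)
pose Q := mx2 c d d (- c).
have uQ : Q \in unitmx.
  rewrite unitmxE det_mx2 unitfE (_ : _ - _ = - q) ?oppr_eq0 ?lt0r_neq0//.
  by rewrite /q; ring.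
pose T := Q *m invmx P1.
have uT : T \in unitmx by rewrite unitmx_mul uQ unitmx_inv.
have TA1 : T *m A1
    = mx2 (- alpha1) (- beta1) beta1 (- alpha1) *m T.
  rewrite hA1 /T !mulmxA mulmxKV//; congr (_ *m _).
  by rewrite !mulmx_mx2; congr mx2; ring.
have TA2 : T *m A2 = mx2 n2 0 k n2 *m T.
  have -> : A2 = P2 *m mx2 n2 1 0 n2 *m mx2 a b c d *m invmx P1.
    by rewrite -hM !mulmxA mulmxK.
  rewrite /T !mulmxA; congr (_ *m _).
  rewrite -(mulmxA Q (invmx P1) P2).
  apply: shear_normal_form => //.
  by rewrite -hM !mulmxA mulmxK// mulVmx.
have tauE : alpha1 * tau12 alpha1 n2 c d eta = flee_growth n2 `|k| eta.
  by rewrite kE /tau12 /flee_growth; field; exact: lt0r_neq0.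
split=> sigma dwell.
- apply: (stable_conj uT TA1 TA2).
  exact: normal_form_stable tauE dwell.
- apply: (asymptotically_stable_conj uT TA1 TA2).
  exact: normal_form_asymptotically_stable tauE dwell.
Qed.
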